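(* Let $\mathcal{H}$ be a $k$-uniform $k$-partite hypergraph with some ordering on its parts, as $V_1, V_2, \ldots, V_k$, such that the subhypergraph $\left\langle \bigcup_{i=1}^{k-1} V_i \right\rangle$ generated on $\bigcup_{i=1}^{k-1} V_i$ has a unique perfect matching $M$. Then $\mathcal{H}$ has a matching of size $t = |V_1|$ if and only if for every subset $A$ of $M$, $|N(A)| \geq |A|$.
   Context: A hypergraph $\mathcal{H}$ on a finite nonempty set $V = V(\mathcal{H})$ is a collection (set) $E(\mathcal{H})$ of nonempty subsets of $V$, called hyperedges, whose union is $V$; elements of $V$ are called vertices. $\mathcal{H}$ is also identified with its set of hyperedges. Two vertices are adjacent if they lie in a common hyperedge. $\mathcal{H}$ is $k$-uniform if all hyperedges have size $k$. $\mathcal{H}$ is $k$-partite ($k \geq 2$) with parts $V_1, \ldots, V_k$ if $V(\mathcal{H})$ is partitioned into $V_1, \ldots, V_k$ so that no two distinct vertices in the same part are adjacent. A matching in a hypergraph is a set of pairwise disjoint hyperedges; its size is the number of hyperedges in it. A perfect matching is a matching such that every vertex of the hypergraph lies in one of its elements. For $\emptyset \neq V' \subseteq V(\mathcal{H})$, the subhypergraph generated on $V'$ is $\langle V' \rangle := \{ e \cap V' \mid e \in E(\mathcal{H}),\ e \cap V' \neq \emptyset \}$, a hypergraph on $V'$. For $\mathcal{H}$ $k$-uniform and $k$-partite, the subhypergraph generated on the union of $k-1$ distinct parts is $(k-1)$-uniform, with each hyperedge containing exactly one vertex of each of these parts. For $\mathcal{H}$ $k$-uniform with $k \geq 2$,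 a submaximal edge is a subset $\mathfrak{e} \subseteq V(\mathcal{H})$ of size $k-1$ contained in some hyperedge of $\mathcal{H}$; its neighborhood is $N(\mathfrak{e}) := \{ v \in V(\mathcal{H}) \mid \mathfrak{e} \cup \{v\} \in E(\mathcal{H}) \}$. For a set $A$ of submaximal edges of $\mathcal{H}$, $N(A) := \{ v \in V(\mathcal{H}) \mid \exists\, \mathfrak{e} \in A,\ v \in N(\mathfrak{e}) \}$. The elements of $M$ are submaximal edges of $\mathcal{H}$, and $N$ is taken with respect to $\mathcal{H}$. *)

(* Defs.v *)
From mathcomp Require Import all_boot.

Set Implicit Arguments.
Unset Strict Implicit.
Unset Printing Implicit Defensive.

(* The ambient finType T only supplies names: the vertex set is V : {set T},
   and a hypergraph is identified with its set of hyperedges. *)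
Section Hypergraphs.
Context {T : finType}.
Implicit Types (V W e : {set T}) (H M A : {set {set T}}).

Definition hypergraph V H : bool :=
  [&& V != set0, set0 \notin H & cover H == V].

Definition adjacent H (x y : T) : bool :=
  [exists e in H, (x \in e) && (y \in e)].

Definition uniform (k : nat) H : bool := [forall e in H, #|e| == k].

(* The parts form an indexed family, so injectivity is what makes parts with
   distinct indices distinct blocks of the partition. *)
Definition partite V H (k : nat) (P : 'I_k -> {set T}) : Prop :=
  [/\ injective P,
      partition [set P i | i : 'I_k] V
    & forall i, {in P i &, forall x y, x != y -> ~~ adjacent H x y}].

Definition matching H M : bool := (M \subset H) && trivIset M.

Definition perfect_matching V H M : bool := matching H M && (cover M == V).

Definition unique_perfect_matching V H M : Prop :=
  perfect_matching V H M /\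
  forall M', perfect_matching V H M' -> M' = M.

Definition generated H W : {set {set T}} :=
  [set e :&: W | e in H & e :&: W != set0].

(* Total in e; meant for a submaximal edge e of a k-uniform H, that is, a set
   of k.-1 vertices contained in some hyperedge. *)
Definition neighborhood V H e : {set T} :=
  [set v in V | e :|: [set v] \in H].

Definition set_neighborhood V H A : {set T} :=
  [set v in V | [exists e in A, v \in neighborhood V H e]].

End Hypergraphs.

(* Main.v *)
Require Import Defs.
From mathcomp Require Import all_boot.

Set Implicit Arguments.
Unset Strict Implicit.
Unset Printing Implicit Defensive.

(** Every hyperedge of a [k]-uniform [k]-partite hypergraph has exactly one
    vertex in each of the [k] parts ([card_edge_part]), so a family of disjoint
    sets with this property for a set [W] has as many members as it covers
    points of [W] ([card_cover_transversal]). In particular all the parts below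
    the last one have size [#|M|].

    Given a matching [Q] of size [#|M|], this count shows that [Q] covers every
    part below the last, so the traces of its hyperedges on [U] form a perfect
    matching of the generated hypergraph; by uniqueness they are exactly [M].
    The members of [Q] extending the elements of [A] are disjoint and each has a
    vertex in the last part, which is a neighbor of its trace: these are at
    least [#|A|] distinct vertices of [N(A)].

    Conversely the condition is Hall's condition for the neighborhoods of the
    elements of [M], and Hall's theorem ([hall_transversal]) gives distinct
    neighbors [f m]. These lie outside [U] ([neighborhood_outside]), because a
    hyperedge must meet the last part; hence the sets [m :|: [set f m]] are
    disjoint hyperedges. *)

(** * Hall's theorem *)

Definition hall_condition (I T : finType) (D : {set I}) (N : I -> {set T}) :=
  forall A : {set I}, A \subset D -> #|A| <= #|\bigcup_(i in A) N i|.

Lemma bigcup_remove_notin (I T : finType) (N : I -> {set T}) (a : I) (x : T)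
    (A : {set I}) : a \notin A ->
  \bigcup_(i in A) (if i == a then N i :\ x else N i) = \bigcup_(i in A) N i.
Proof.
move=> aA; apply: eq_bigr => i iA.
by case: eqP aA => // <-; rewrite iA.
Qed.

(** A violation of Hall's condition after the deletion of [x] from [N a] must
    involve [a], since the other sets are unchanged. *)
Lemma remove_point_violation (I T : finType) (D : {set I}) (N : I -> {set T})
    (a : I) (x : T) :
  a \in D -> hall_condition D N ->
  hall_condition D (fun i => if i == a then N i :\ x else N i) \/
  exists A : {set I}, [/\ a \notin A, A \subset D
    & #|N a :\ x :|: \bigcup_(i in A) N i| <= #|A|].
Proof.
move=> aD hN; set N' := fun i => _.
case: (boolP [forall A : {set I}, (A \subset D) ==>
                (#|A| <= #|\bigcup_(i in A) N' i|)]) => [/forallP h | ].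
  by left=> A AD; have /implyP := h A; apply.
rewrite negb_forall => /existsP[A]; rewrite negb_imply -ltnNge => /andP[AD lt].
case: (boolP (a \in A)) => [aA | aA]; last first.
  by move: lt; rewrite bigcup_remove_notin // ltnNge hN.
right; exists (A :\ a); split.
- by rewrite !inE eqxx.
- by apply: subset_trans AD; apply: subsetDl.
have aA' : a \notin A :\ a by rewrite !inE eqxx.
move: lt; rewrite (cardsD1 a A) aA add1n ltnS.
rewrite (big_setD1 a aA) /= bigcup_remove_notin //.
by rewrite /N' eqxx.
Qed.

(** If deleting [x] is blocked by [A] and deleting [y] by [B], then
    submodularity of cardinality applied to the two blocked neighborhoods
    contradicts the condition at [a |: (A :|: B)] and at [A :&: B]. *)
Lemma hall_condition_remove (I T : finType) (D : {set I}) (N : I -> {set T})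
    (a : I) (x y : T) :
  a \in D -> x != y -> hall_condition D N ->
  exists z, z \in [set x; y] /\
    hall_condition D (fun i => if i == a then N i :\ z else N i).
Proof.
move=> aD xy hN.
have [h | [A [aA AD hA]]] := remove_point_violation x aD hN.
  by exists x; rewrite !inE eqxx.
have [h | [B [aB BD hB]]] := remove_point_violation y aD hN.
  by exists y; rewrite !inE eqxx orbT.
exfalso; set X := _ :|: _ in hA; set Y := _ :|: _ in hB.
have hU : #|a |: (A :|: B)| <= #|X :|: Y|.
  apply: leq_trans (hN _ _) _; first by rewrite !subUset sub1set aD AD.
  apply/subset_leq_card/bigcupsP => i /setU1P[-> | /setUP[] iAB].
  - apply/subsetP => z za; rewrite !inE za !andbT.
    by case: eqP => //= ->; rewrite xy orbT.
  - apply: subset_trans (subsetUl X Y); apply: subset_trans (subsetUr _ _).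
    exact: bigcup_sup.
  - apply: subset_trans (subsetUr X Y); apply: subset_trans (subsetUr _ _).
    exact: bigcup_sup.
have hI : #|A :&: B| <= #|X :&: Y|.
  apply: leq_trans (hN _ _) _; first exact: subset_trans (subsetIl _ _) AD.
  apply/subset_leq_card/bigcupsP => i /setIP[iA iB].
  rewrite subsetI; apply/andP; split; apply: subset_trans (subsetUr _ _);
    exact: bigcup_sup.
have aAB : a \notin A :|: B by rewrite inE negb_or aA.
rewrite cardsU1 aAB in hU.
have := leq_add hU hI; rewrite cardsUI -addnA cardsUI add1n.
by rewrite ltnNge leq_add.
Qed.

(** Rado's argument: points can be deleted from any [N a] with at least two of
    them while keeping Hall's condition, until all the sets are singletons; the
    condition on pairs then says that these singletons are distinct. The point
    [x0] gives [f] a value outside [D], where nothing constrains it. *)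
Lemma hall_transversal (I T : finType) (x0 : T) (D : {set I})
    (N : I -> {set T}) :
  hall_condition D N ->
  exists2 f : I -> T, {in D &, injective f} & {in D, forall i, f i \in N i}.
Proof.
have [n] := ubnP (\sum_(i in D) #|N i|).
elim: n N => // n IH N; rewrite ltnS => le_n hN.
case: (boolP [forall i in D, #|N i| <= 1]) => [/forall_inP le1 | ].
  pose f i := odflt x0 [pick x in N i].
  have fN i : i \in D -> f i \in N i.
    move=> iD; rewrite /f; case: pickP => //= N0.
    have := hN [set i]; rewrite sub1set iD cards1 big_set1 => /(_ isT).
    by rewrite (eq_card0 N0).
  exists f => // i j iD jD eqf.
  have := hN [set i; j]; rewrite subUset !sub1set iD jD => /(_ isT).
  apply: contraTeq => ij; rewrite cards2 ij -ltnNge ltnS /= -(cards1 (f i)).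
  apply/subset_leq_card/bigcupsP => l /set2P[->|->]; apply/subsetP => z zN.
    by rewrite inE (card_le1_eqP (le1 i iD) z (f i)) ?fN.
  by rewrite inE eqf (card_le1_eqP (le1 j jD) z (f j)) ?fN.
rewrite negb_forall_in => /exists_inP[a aD]; rewrite -ltnNge.
case/card_gt1P=> x [y [xa ya xy]].
have [z [zxy hz]] := hall_condition_remove aD xy hN.
have za : z \in N a by case/set2P: zxy => ->.
have [|f injf fN] := IH _ _ hz.
  apply: leq_trans le_n; rewrite (bigD1 a) //= [X in _ < X](bigD1 a) //= eqxx.
  rewrite [X in _ < X + _](cardsD1 z) za -addnA add1n ltnS leq_add2l.
  by apply: leq_sum => i /andP[_ /negbTE ->].
exists f => // i iD; have := fN i iD.
by case: eqP => // _ /setD1P[].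
Qed.

(** * Hyperedges and parts *)

(** The points of [W] covered by [F] are counted member by member. *)
Lemma card_cover_transversal (T : finType) (F : {set {set T}}) (W : {set T}) :
  trivIset F -> {in F, forall e, #|e :&: W| = 1} -> #|cover F :&: W| = #|F|.
Proof.
move=> tF h1; rewrite -sum1_card.
under eq_bigl do rewrite inE.
rewrite big_trivIset_cond // -[RHS]sum1_card; apply: eq_bigr => e eF.
by apply: etrans (h1 e eF); rewrite -sum1_card; apply: eq_bigl => x; rewrite inE.
Qed.

Lemma partite_cover (T : finType) (V : {set T}) (H : {set {set T}}) (k : nat)
    (P : 'I_k -> {set T}) :
  partite V H P -> \bigcup_i P i = V.
Proof.
by case=> _ /and3P[/eqP <- _ _] _; rewrite cover_imset.
Qed.

Lemma partite_disjoint (T : finType) (V : {set T}) (H : {set {set T}})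
    (k : nat) (P : 'I_k -> {set T}) (i j : 'I_k) :
  partite V H P -> i != j -> [disjoint P i & P j].
Proof.
case=> injP /and3P[_ /trivIsetP tP _] _ ij.
by apply: tP; rewrite ?imset_f // (inj_eq injP).
Qed.

(** A hyperedge has [k] vertices and at most one of them in each of the [k]
    parts, so all these bounds are attained. *)
Lemma card_edge_part (T : finType) (V : {set T}) (H : {set {set T}}) (k : nat)
    (P : 'I_k -> {set T}) (e : {set T}) (i : 'I_k) :
  hypergraph V H -> uniform k H -> partite V H P -> e \in H ->
  #|e :&: P i| = 1.
Proof.
move=> /and3P[_ _ /eqP covH] /forall_inP unifH partP eH.
have le1 j : true -> #|e :&: P j| <= 1 ?= iff (#|e :&: P j| == 1).
  move=> _; apply/leqif_eq/card_le1_eqP => y x /setIP[ye yP] /setIP[xe xP].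
  case: partP => _ _ /(_ j x y xP yP) /contraTeq; apply.
  by apply/exists_inP; exists e => //; rewrite xe ye.
have [ub eq1] := leqif_sum le1.
suff tight : \sum_j #|e :&: P j| == \sum_(j < k) 1.
  by move: eq1; rewrite tight => /esym/forall_inP/(_ i isT)/eqP.
rewrite eqn_leq ub /= sum1_card card_ord.
have /eqP cardE := unifH e eH; rewrite -[X in X <= _]cardE.
have eE : e = \bigcup_j (e :&: P j).
  rewrite -big_distrr /= (partite_cover partP) -covH; apply/esym/setIidPl.
  exact: bigcup_sup.
rewrite {1}eE.
elim/big_rec2: _ => [|j B n _ le_n]; first by rewrite cards0.
by apply: leq_trans (leq_card_setU _ _) _; rewrite leq_add2l.
Qed.

Lemma partite_last (T : finType) (V : {set T}) (H : {set {set T}}) (k : nat)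
    (P : 'I_k -> {set T}) (l : 'I_k) :
  partite V H P -> l = k.-1 :> nat ->
  (\bigcup_(i < k | i < k.-1) P i) :|: P l = V /\
  [disjoint \bigcup_(i < k | i < k.-1) P i & P l].
Proof.
move=> partP lE; split.
  rewrite -(partite_cover partP) [RHS](bigD1 l) //= setUC; congr (_ :|: _).
  apply: eq_bigl => i; rewrite -val_eqE /= lE ltn_neqAle -ltnS prednK ?ltn_ord.
    by rewrite andbT.
  by apply: leq_ltn_trans (ltn_ord i).
rewrite disjoint_sym; apply: bigcup_disjoint => i; rewrite -lE => il.
by apply: partite_disjoint partP _; rewrite -val_eqE neq_ltn il orbT.
Qed.

(** A neighbor inside [U] would give a hyperedge that misses [W]. *)
Lemma neighborhood_outside (T : finType) (V : {set T}) (H : {set {set T}})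
    (U W m : {set T}) (v : T) :
  {in H, forall e, #|e :&: W| = 1} -> [disjoint U & W] -> m \subset U ->
  v \in neighborhood V H m -> v \notin U.
Proof.
move=> h1 dUW mU; rewrite inE => /andP[_ /h1 meets]; apply/negP => vU.
have : (m :|: [set v]) :&: W \subset U :&: W.
  by apply: setSI; rewrite subUset mU sub1set.
by rewrite (disjoint_setI0 dUW) subset0 -cards_eq0 meets.
Qed.

Lemma set_neighborhoodE (T : finType) (V : {set T}) (H A : {set {set T}}) :
  set_neighborhood V H A = \bigcup_(m in A) neighborhood V H m.
Proof.
apply/setP => v; rewrite inE; apply/andP/bigcupP.
  by case=> _ /exists_inP[m mA vm]; exists m.
case=> m mA vm; split; last by apply/exists_inP; exists m.
by move: vm; rewrite inE => /andP[].
Qed.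

(** * Matchings and their traces *)

Lemma trivIset_trace (T : finType) (Q : {set {set T}}) (U : {set T}) :
  trivIset Q -> trivIset [set e :&: U | e in Q].
Proof.
move=> /trivIsetP tQ; apply/trivIsetP => _ _ /imsetP[e eQ ->] /imsetP[e' eQ' ->].
move=> ne; apply: disjointW (tQ e e' eQ eQ' _); try exact: subsetIl.
by apply: contra ne => /eqP ->.
Qed.

Lemma cover_trace (T : finType) (Q : {set {set T}}) (U : {set T}) :
  cover [set e :&: U | e in Q] = cover Q :&: U.
Proof. by rewrite cover_imset -big_distrl. Qed.

(** The members of [Q] with trace in [A] are at least [#|A|] and have distinct
    vertices in [W], each of which extends its trace to a hyperedge. *)
Lemma trace_neighborhood_bound (T : finType) (V : {set T})
    (H Q A : {set {set T}}) (U W : {set T}) :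
  cover H = V -> {in H, forall e, #|e :&: W| = 1} -> U :|: W = V ->
  matching H Q -> A \subset [set e :&: U | e in Q] ->
  #|A| <= #|set_neighborhood V H A|.
Proof.
move=> covH h1 UW /andP[QH tQ] AQ.
pose B := [set e in Q | e :&: U \in A].
have BQ : B \subset Q by apply/subsetP => e; rewrite inE => /andP[].
have AB : A \subset [set e :&: U | e in B].
  apply/subsetP => m mA; have /imsetP[e eQ mE] := subsetP AQ m mA.
  by apply/imsetP; exists e; rewrite // inE eQ -mE.
apply: leq_trans (subset_leq_card AB) _.
apply: leq_trans (leq_imset_card _ _) _.
rewrite -(card_cover_transversal (trivIsetS BQ tQ) (W := W)); last first.
  by move=> e eB; apply: h1; apply: (subsetP QH); apply: (subsetP BQ).
apply/subset_leq_card/subsetP => v /setIP[/bigcupP[e eB ve] vW].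
move: eB; rewrite inE => /andP[eQ eA]; have eH := subsetP QH e eQ.
have eV : e \subset V by rewrite -covH; apply: bigcup_sup.
rewrite set_neighborhoodE; apply/bigcupP; exists (e :&: U) => //.
rewrite inE (subsetP eV v ve) /=.
suff <- : e = e :&: U :|: [set v] by [].
have /eqP/cards1P[w wE] := h1 e eH.
have : v \in e :&: W by rewrite inE ve.
rewrite wE inE => /eqP ->; rewrite -wE -setIUr UW; exact/esym/setIidPl.
Qed.

(** Adjoining to disjoint subsets of [U] distinct points outside [U] keeps them
    distinct, their traces on [U] being unchanged, and disjoint. *)
Lemma extend_matching (T : finType) (M : {set {set T}}) (U : {set T})
    (f : {set T} -> T) :
  trivIset M -> {in M, forall m : {set T}, m \subset U} ->
  {in M, forall m, f m \notin U} -> {in M &, injective f} ->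
  trivIset [set m :|: [set f m] | m in M] /\
  #|[set m :|: [set f m] | m in M]| = #|M|.
Proof.
move=> /trivIsetP tM MU fU injf; split.
  apply/trivIsetP => _ _ /imsetP[m mM ->] /imsetP[n nM ->] ne.
  have mn : m != n by apply: contra ne => /eqP ->.
  have dU l (X : {set T}) : l \in M -> X \subset U -> [disjoint [set f l] & X].
    by move=> lM XU; rewrite disjoints1; apply: contra (fU l lM); apply/subsetP.
  rewrite -setI_eq0 setIUl !setIUr !setU_eq0 !setI_eq0 tM //=.
  rewrite (disjoint_sym m) (dU n m) ?(dU m n) ?MU //=.
  rewrite disjoints1 inE.
  by apply: contra mn => /eqP /injf ->.
apply: card_in_imset => m n mM nM E.
have traceE l : l \in M -> (l :|: [set f l]) :&: U = l.
  move=> lM; rewrite setIUl (setIidPl (MU l lM)).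
  by rewrite disjoint_setI0 ?setU0 // disjoints1 fU.
by rewrite -(traceE m mM) E traceE.
Qed.

Theorem theorem2p1 (T : finType) (V : {set T}) (H : {set {set T}})
    (k : nat) (hk : 1 < k) (P : 'I_k -> {set T}) (M : {set {set T}})
    (hH : hypergraph V H) (hunif : uniform k H) (hpart : partite V H P)
    (hM : let U := \bigcup_(i < k | i < k.-1) P i in
          unique_perfect_matching U (generated H U) M) :
  (exists2 Q : {set {set T}},
     matching H Q & #|Q| = #|P (Ordinal (ltnW hk))|) <->
  (forall A : {set {set T}}, A \subset M -> #|A| <= #|set_neighborhood V H A|).
Proof.
have card1 i : {in H, forall e, #|e :&: P i| = 1}.
  by move=> e; apply: card_edge_part hH hunif hpart.
have lt_last : k.-1 < k by rewrite ltn_predL ltnW.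
have [UPV dUP] := partite_last (l := Ordinal lt_last) hpart erefl.
set i0 := Ordinal (ltnW hk).
have lt_i0 : i0 < k.-1 by rewrite -ltnS prednK // ltnW.
move: hM => /=; move: UPV dUP; set U := \bigcup_(i < k | _) _; set W := P _.
move=> UPV dUP [/andP[/andP[MH tM] /eqP covM] uniqM].
have subU (i : 'I_k) : i < k.-1 -> P i \subset U by move=> lti; apply: bigcup_sup.
have trace_part (i : 'I_k) (e : {set T}) : i < k.-1 -> e :&: U :&: P i = e :&: P i.
  by move=> lti; rewrite -setIA (setIidPr (subU i lti)).
have cardM (i : 'I_k) : i < k.-1 -> #|M| = #|P i|.
  move=> lti; rewrite -(card_cover_transversal tM (W := P i)).
    by rewrite covM (setIidPr (subU i lti)).
  move=> m /(subsetP MH)/imsetP[e]; rewrite inE => /andP[eH _] ->.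
  by rewrite trace_part // card1.
have /and3P[V0 _ /eqP covH] := hH.
split=> [[Q mQ cardQ] A AM | hallM].
- have /andP[QH tQ] := mQ.
  suff traceM : [set e :&: U | e in Q] = M.
    apply: trace_neighborhood_bound covH (card1 (Ordinal lt_last)) UPV mQ _.
    by rewrite traceM.
  (* [Q] has as many hyperedges as any part of [U] has vertices. *)
  have coverU : U \subset cover Q.
    apply/bigcupsP => i lti; apply/setIidPr/eqP.
    rewrite eqEcard subsetIr card_cover_transversal //=.
      by rewrite cardQ -(cardM i0) // (cardM i).
    by move=> e eQ; apply: card1; apply: (subsetP QH).
  apply: uniqM; rewrite /perfect_matching /matching trivIset_trace //.
  rewrite cover_trace (setIidPr coverU) eqxx !andbT.
  apply/subsetP => _ /imsetP[e eQ ->]; have eH := subsetP QH e eQ.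
  apply: imset_f; rewrite inE eH -card_gt0 /=.
  apply: leq_trans (subset_leq_card (subsetIl _ (P i0))).
  by rewrite trace_part // card1.
- have [x0 _] := set0Pn _ V0.
  have [|f injf fN] := @hall_transversal _ _ x0 M (neighborhood V H).
    by move=> A AM; rewrite -set_neighborhoodE hallM.
  have MU : {in M, forall m : {set T}, m \subset U}.
    by move=> m mM; rewrite -covM; apply: bigcup_sup.
  have fU : {in M, forall m, f m \notin U}.
    move=> m mM; apply: neighborhood_outside (card1 _) dUP (MU m mM) _.
    exact: fN.
  have [tQ cardQ] := extend_matching tM MU fU injf.
  exists [set m :|: [set f m] | m in M]; last by rewrite cardQ (cardM i0).
  rewrite /matching tQ andbT; apply/subsetP => _ /imsetP[m mM ->].
  by have := fN m mM; rewrite inE => /andP[].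
Qed.
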